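(* Let $B$ and $C$ be finite-dimensional algebras over a field $k$, let $M$ be a finitely generated $C$-$B$-bimodule, and let $A=\begin{pmatrix} B & 0\\ {}_CM_B & C\end{pmatrix}$ be the triangular matrix algebra. If $$\alpha:\ 0=\mathscr{X}_0\subsetneq\mathscr{X}_1\subsetneq\cdots\subsetneq\mathscr{X}_{r-1}\subsetneq\mathscr{X}_r=\operatorname{mod}B$$ and $$\beta:\ 0=\mathscr{Y}_0\subsetneq\mathscr{Y}_1\subsetneq\cdots\subsetneq\mathscr{Y}_{s-1}\subsetneq\mathscr{Y}_s=\operatorname{mod}C$$ are respectively maximal green sequences in $\operatorname{mod}B$ and $\operatorname{mod}C$, then $$\gamma:\ 0=\mathscr{Z}_0\subsetneq\mathscr{Z}_1\subsetneq\cdots\subsetneq\mathscr{Z}_r\subsetneq\mathscr{Z}_{r+1}\subsetneq\cdots\subsetneq\mathscr{Z}_{r+s-1}\subsetneq\mathscr{Z}_{r+s}=\operatorname{mod}A$$ is a maximal green sequence in $\operatorname{mod}A$, where $\mathscr{Z}_i=\{(X,0)\mid X\in\mathscr{X}_i\}$ for $0\le i\le r$ and $\mathscr{Z}_{r+j}=\{(X,Y)_f\mid X\in\operatorname{mod}B,\ Y\in\mathscr{Y}_j\}$ for $1\le j\le s$. In particular, the lengths of $\alpha$ and $\beta$ sum up to that of $\gamma$.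
   Context: $\operatorname{mod}A$ is the category of finitely generated right $A$-modules. A torsion class in $\operatorname{mod}A$ is a full subcategory closed under images (factor modules), direct sums and extensions. A maximal green sequence in $\operatorname{mod}A$ is a finite sequence of torsion classes $0=\mathscr{T}_0\subsetneq\mathscr{T}_1\subsetneq\cdots\subsetneq\mathscr{T}_r=\operatorname{mod}A$ such that for all $0\le i\le r-1$ the inclusion $\mathscr{T}_i\subsetneq\mathscr{T}_{i+1}$ is a covering relation, i.e. any torsion class $\mathscr{T}$ with $\mathscr{T}_i\subseteq\mathscr{T}\subseteq\mathscr{T}_{i+1}$ satisfies $\mathscr{T}=\mathscr{T}_i$ or $\mathscr{T}=\mathscr{T}_{i+1}$. The length of such a sequence is $r$. Modules over the triangular matrix algebra: a right $A$-module is identified with a triple $(X,Y)_f$ (or $(X,Y)$ if $f$ is clear), where $X$ is a right $B$-module, $Y$ is a right $C$-module and $f:Y\otimes_C M\to X$ is a right $B$-module map. A morphism $(X,Y)_f\to(X',Y')_{f'}$ is a pair $(\alpha,\beta)$ with $\alpha\in\operatorname{Hom}_B(X,X')$, $\beta\in\operatorname{Hom}_C(Y,Y')$ and $\alpha f=f'(\beta\otimes \mathrm{id}_M)$. *)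

(* Defs.v *)
From HB Require Import structures.
From mathcomp Require Import all_boot all_order all_algebra.
From mathcomp Require Import boolp.

Set Implicit Arguments.
Unset Strict Implicit.
Unset Printing Implicit Defensive.

Import GRing.Theory.

Local Open Scope ring_scope.
Local Open Scope quotient_scope.

Definition fin_gen (R : pzRingType) (V : lmodType R) : Prop :=
  exists (n : nat) (g : 'I_n -> V),
    forall v : V, exists c : 'I_n -> R, v = \sum_(i < n) c i *: g i.

(* Algebras over a field, as rings with a central structure map. The library's
   algType and falgType impose 1 != 0; the zero algebra is allowed here. *)
Record algebra (k : fieldType) := Algebra {
  alg_ring :> pzRingType;
  alg_scalar : {rmorphism k -> alg_ring};
  alg_central : forall (a : k) (x : alg_ring),
    alg_scalar a * x = x * alg_scalar a
}.

Definition fin_dim (k : fieldType) (A : algebra k) : Prop :=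
  exists (n : nat) (e : 'I_n -> A),
    forall x : A, exists c : 'I_n -> k,
      x = \sum_(i < n) alg_scalar A (c i) * e i.

Definition algebra_of_algType (k : fieldType) (A : algType k) : algebra k :=
  @Algebra k A (in_alg A : {rmorphism k -> A})
    (fun a x => etrans (mulr_algl a x) (esym (mulr_algr a x))).

(* A right R-module is a left module over the converse ring R^c. *)
Notation rmodType R := (lmodType R^c).

Definition ract (R : pzRingType) (V : rmodType R) (v : V) (a : R) : V :=
  (a : R^c) *: v.

Definition lin_iso (R : pzRingType) (V W : lmodType R) : Prop :=
  exists f : {linear V -> W}, bijective f.

Definition modclass (R : pzRingType) := rmodType R -> Prop.

Section Classes.
Variable R : pzRingType.
Implicit Types S T : modclass R.

Definition class_sub S T : Prop := forall V : rmodType R, S V -> T V.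

Definition class_eq S T : Prop := forall V : rmodType R, S V <-> T V.

Definition zero_class : modclass R := fun V => forall v : V, v = 0.

Definition mod_class : modclass R := fun V => fin_gen V.

Record torsion_class T : Prop := TorsionClass {
  torsion_mod : class_sub T mod_class;
  torsion_zero : class_sub zero_class T;
  torsion_image : forall (V W : rmodType R) (p : {linear V -> W}),
    (forall w, exists v, p v = w) -> T V -> T W;
  torsion_sum : forall V W : rmodType R, T V -> T W -> T (V * W)%type;
  torsion_ext : forall (U V W : rmodType R)
      (i : {linear U -> V}) (p : {linear V -> W}),
    injective i -> (forall w, exists v, p v = w) ->
    (forall v, p v = 0 <-> exists u, i u = v) ->
    T U -> T W -> T V
}.

Definition covers S T : Prop :=
  [/\ class_sub S T, ~ class_eq S T
    & forall U, torsion_class U -> class_sub S U -> class_sub U T ->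
        class_eq U S \/ class_eq U T].

(* Only T 0, ..., T r are constrained; r is the length. *)
Definition maximal_green_sequence (r : nat) (T : nat -> modclass R) : Prop :=
  [/\ forall i, (i <= r)%N -> torsion_class (T i),
      class_eq (T 0%N) zero_class,
      class_eq (T r) mod_class
    & forall i, (i < r)%N -> covers (T i) (T i.+1)].

End Classes.

(* k acts centrally: the actions of k through C and through B agree. *)
Record bimodule (k : fieldType) (C B : algebra k) := Bimodule {
  bimod_left :> lmodType C;
  bact : bimod_left -> B -> bimod_left;
  bact1 : forall m, bact m 1 = m;
  bactM : forall m b b', bact m (b * b') = bact (bact m b) b';
  bactDl : forall m m' b, bact (m + m') b = bact m b + bact m' b;
  bactDr : forall m b b', bact m (b + b') = bact m b + bact m b';
  bactC : forall c m b, bact (c *: m) b = c *: bact m b;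
  bact_central : forall (a : k) m, bact m (alg_scalar B a) = alg_scalar C a *: m
}.

Definition bimod_fin_gen (k : fieldType) (C B : algebra k)
    (M : bimodule C B) : Prop :=
  exists (n : nat) (g : 'I_n -> M), forall m : M,
    exists (p : nat) (j : 'I_p -> 'I_n) (c : 'I_p -> C) (b : 'I_p -> B),
      m = \sum_(i < p) c i *: bact (g (j i)) (b i).

Section Triangular.
Variables (k : fieldType) (C B : algebra k) (M : bimodule C B).

(* ((b, m), c) stands for the matrix with rows (b, 0) and (m, c). *)
Definition tri_ring : Type := (B * M * C)%type.

HB.instance Definition _ := GRing.Zmodule.on tri_ring.

Implicit Types t u v : tri_ring.

Definition tri_one : tri_ring := (1, 0, 1).

Definition tri_mul t u : tri_ring :=
  (t.1.1 * u.1.1, bact t.1.2 u.1.1 + t.2 *: u.1.2, t.2 * u.2).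

Lemma bact0r (m : M) : bact m 0 = 0.
Proof. by apply: (addrI (bact m 0)); rewrite -bactDr !addr0. Qed.

Lemma bact0l (b : B) : bact (0 : M) b = 0.
Proof. by apply: (addrI (bact (0 : M) b)); rewrite -bactDl !addr0. Qed.

Lemma tri_mulA : associative tri_mul.
Proof.
case=> [[b m] c] [[b' m'] c'] [[b'' m''] c'']; rewrite /tri_mul /=.
by rewrite !mulrA bactDl bactM bactC scalerDr scalerA addrA.
Qed.

Lemma tri_mul1r : left_id tri_one tri_mul.
Proof.
by case=> [[b m] c]; rewrite /tri_mul /= !mul1r bact0l scale1r add0r.
Qed.

Lemma tri_mulr1 : right_id tri_one tri_mul.
Proof.
by case=> [[b m] c]; rewrite /tri_mul /= !mulr1 bact1 scaler0 addr0.
Qed.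

Lemma tri_mulDl : left_distributive tri_mul +%R.
Proof.
case=> [[b m] c] [[b' m'] c'] [[b'' m''] c''].
by congr (_, _, _); rewrite /= ?mulrDl // bactDl scalerDl addrACA.
Qed.

Lemma tri_mulDr : right_distributive tri_mul +%R.
Proof.
case=> [[b m] c] [[b' m'] c'] [[b'' m''] c''].
by congr (_, _, _); rewrite /= ?mulrDr // bactDr scalerDr addrACA.
Qed.

HB.instance Definition _ := GRing.Zmodule_isPzRing.Build tri_ring
  tri_mulA tri_mul1r tri_mulr1 tri_mulDl tri_mulDr.

Definition tri_scalar (a : k) : tri_ring :=
  (alg_scalar B a, 0, alg_scalar C a).

Fact tri_scalar_is_zmod_morphism : zmod_morphism tri_scalar.
Proof. by move=> a a'; congr (_, _, _); rewrite ?rmorphB //= subr0. Qed.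

Fact tri_scalar_is_monoid_morphism : monoid_morphism tri_scalar.
Proof.
split=> [|a a']; congr (_, _, _); rewrite /= ?rmorph1 ?rmorphM //.
by rewrite bact0l scaler0 addr0.
Qed.

HB.instance Definition _ := GRing.isZmodMorphism.Build k tri_ring tri_scalar
  tri_scalar_is_zmod_morphism.
HB.instance Definition _ := GRing.isMonoidMorphism.Build k tri_ring tri_scalar
  tri_scalar_is_monoid_morphism.

Lemma tri_scalar_central (a : k) t : tri_scalar a * t = t * tri_scalar a.
Proof.
case: t => [[b m] c]; congr (_, _, _); rewrite /= ?alg_central //.
by rewrite bact0l scaler0 add0r addr0 bact_central.
Qed.

Definition tri_alg : algebra k := @Algebra k tri_ring tri_scalar
  tri_scalar_central.

End Triangular.

(* Y (x)_C M, as a quotient of the free commutative monoid on Y x M (finite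
   sequences of pairs); opposites come from (- y) (x) m. *)
Section Tensor.
Variables (k : fieldType) (C B : algebra k).
Variables (Y : rmodType C) (M : bimodule C B).

Inductive tens_rel : seq (Y * M) -> seq (Y * M) -> Prop :=
| tens_refl s : tens_rel s s
| tens_sym s t : tens_rel s t -> tens_rel t s
| tens_trans s t u : tens_rel s t -> tens_rel t u -> tens_rel s u
| tens_cat s s' t t' :
    tens_rel s s' -> tens_rel t t' -> tens_rel (s ++ t) (s' ++ t')
| tens_catC s t : tens_rel (s ++ t) (t ++ s)
| tens_rel0 m : tens_rel [:: (0, m)] [::]
| tens_relDl y y' m : tens_rel [:: (y + y', m)] [:: (y, m); (y', m)]
| tens_relDr y m m' : tens_rel [:: (y, m + m')] [:: (y, m); (y, m')]
| tens_relC y c m : tens_rel [:: (ract y c, m)] [:: (y, c *: m)].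

Definition tens_eq (s t : seq (Y * M)) : bool := `[< tens_rel s t >].

Lemma tens_eq_refl : reflexive tens_eq.
Proof. by move=> s; apply/asboolP/tens_refl. Qed.

Lemma tens_eq_sym : symmetric tens_eq.
Proof. by move=> s t; apply/asboolP/asboolP => /tens_sym. Qed.

Lemma tens_eq_trans : transitive tens_eq.
Proof.
by move=> t s u /asboolP st /asboolP tu; apply/asboolP/(tens_trans st).
Qed.

Canonical tens_equiv := EquivRel tens_eq tens_eq_refl tens_eq_sym tens_eq_trans.

Definition tensor : Type := {eq_quot tens_equiv}.

HB.instance Definition _ := Choice.on tensor.
HB.instance Definition _ := Quotient.on tensor.

Lemma tens_piE (s t : seq (Y * M)) :
  tens_rel s t <-> \pi_tensor s = \pi_tensor t.
Proof.
split=> [st|st]; first by apply/(eqmodP (tens_equiv))/asboolP.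
by move/(eqmodP (tens_equiv)): st => /asboolP.
Qed.

Definition tens (y : Y) (m : M) : tensor := \pi_tensor [:: (y, m)].

Lemma tens_repr (s : seq (Y * M)) : tens_rel (repr (\pi_tensor s)) s.
Proof. by apply/tens_piE; rewrite reprK. Qed.

Lemma tens_surj (x : tensor) : {s | x = \pi_tensor s}.
Proof. by exists (repr x); rewrite reprK. Qed.

Definition tens_zero : tensor := \pi_tensor [::].

Definition tens_add (x y : tensor) : tensor := \pi_tensor (repr x ++ repr y).

Definition tens_oppseq (s : seq (Y * M)) := [seq (- p.1, p.2) | p <- s].

Definition tens_opp (x : tensor) : tensor := \pi_tensor (tens_oppseq (repr x)).

Definition tens_actseq (b : B) (s : seq (Y * M)) :=
  [seq (p.1, bact p.2 b) | p <- s].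

Definition tens_scale (b : B^c) (x : tensor) : tensor :=
  \pi_tensor (tens_actseq b (repr x)).

Lemma tens_addE s t :
  tens_add (\pi_tensor s) (\pi_tensor t) = \pi_tensor (s ++ t).
Proof. by apply/tens_piE/tens_cat; apply: tens_repr. Qed.

Lemma tens_addA : associative tens_add.
Proof.
move=> x y z; have [[s ->] [t ->]] := (tens_surj x, tens_surj y).
by have [u ->] := tens_surj z; rewrite !tens_addE catA.
Qed.

Lemma tens_addC : commutative tens_add.
Proof.
move=> x y; have [[s ->] [t ->]] := (tens_surj x, tens_surj y).
rewrite !tens_addE.
exact/tens_piE/tens_catC.
Qed.

Lemma tens_add0 : left_id tens_zero tens_add.
Proof. by move=> x; have [s ->] := tens_surj x; rewrite tens_addE. Qed.

Lemma tens_oppseqE s : tens_rel (tens_oppseq s ++ s) [::].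
Proof.
elim: s => [|[y m] s IHs]; first exact: tens_refl.
apply: (@tens_trans _ ([:: (- y, m); (y, m)] ++ (tens_oppseq s ++ s))).
  rewrite -[(y, m) :: s]cat1s.
  change (tens_rel ([:: (- y, m)] ++ (tens_oppseq s ++ ([:: (y, m)] ++ s)))
                   ([:: (- y, m)] ++ ([:: (y, m)] ++ (tens_oppseq s ++ s)))).
  apply: tens_cat; first exact: tens_refl.
  by rewrite !catA; apply: tens_cat; [apply: tens_catC | apply: tens_refl].
rewrite -[[::]]cats0; apply: tens_cat => //.
apply: tens_trans (tens_sym (tens_relDl _ _ _)) _.
by rewrite addNr; apply: tens_rel0.
Qed.

Lemma tens_addN : left_inverse tens_zero tens_opp tens_add.
Proof.
move=> x; rewrite -{2}[x]reprK /tens_opp tens_addE.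
exact/tens_piE/tens_oppseqE.
Qed.

HB.instance Definition _ := GRing.isZmodule.Build tensor
  tens_addA tens_addC tens_add0 tens_addN.

Lemma tens_actseqE b s t :
  tens_rel s t -> tens_rel (tens_actseq b s) (tens_actseq b t).
Proof.
elim=> {s t}.
- by move=> s; apply: tens_refl.
- by move=> s t _ /tens_sym.
- by move=> s t u _ st _; apply: tens_trans st.
- by move=> s s' t t' _ ss' _ tt'; rewrite /tens_actseq !map_cat; apply: tens_cat.
- by move=> s t; rewrite /tens_actseq !map_cat; apply: tens_catC.
- by move=> m; apply: tens_rel0.
- by move=> y y' m; apply: tens_relDl.
- by move=> y m m'; rewrite /= bactDl; apply: tens_relDr.
- by move=> y c m; rewrite /= bactC; apply: tens_relC.
Qed.

Lemma tens_scaleE b s :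
  tens_scale b (\pi_tensor s) = \pi_tensor (tens_actseq b s).
Proof. exact/tens_piE/tens_actseqE/tens_repr. Qed.

Lemma tens_scalerA b b' x :
  tens_scale b (tens_scale b' x) = tens_scale (b * b') x.
Proof.
have [s ->] := tens_surj x; rewrite !tens_scaleE /tens_actseq -map_comp.
by congr (\pi _); apply: eq_map => p /=; rewrite -bactM.
Qed.

Lemma tens_scale1r : left_id 1 tens_scale.
Proof.
move=> x; have [s ->] := tens_surj x; rewrite tens_scaleE; congr (\pi _).
by rewrite -[RHS]map_id; apply: eq_map => -[y m] /=; rewrite bact1.
Qed.

Lemma tens_scalerDr : right_distributive tens_scale +%R.
Proof.
move=> b x y; have [[s ->] [t ->]] := (tens_surj x, tens_surj y).
change (tens_scale b (tens_add (\pi_tensor s) (\pi_tensor t)) =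
  tens_add (tens_scale b (\pi_tensor s)) (tens_scale b (\pi_tensor t))).
rewrite [in LHS]tens_addE !tens_scaleE tens_addE.
by rewrite /tens_actseq map_cat.
Qed.

Lemma tens_scalerDl x : {morph tens_scale^~ x : b b' / b + b'}.
Proof.
move=> b b'; have [s ->] := tens_surj x.
change (tens_scale (b + b') (\pi_tensor s) =
  tens_add (tens_scale b (\pi_tensor s)) (tens_scale b' (\pi_tensor s))).
rewrite !tens_scaleE tens_addE; apply/tens_piE.
elim: s => [|[y m] s IHs]; first exact: tens_refl.
apply: (@tens_trans _ ([:: (y, bact m b); (y, bact m b')] ++
                       (tens_actseq b s ++ tens_actseq b' s))).
  change (tens_rel ([:: (y, bact m (b + b'))] ++ tens_actseq (b + b') s)
    ([:: (y, bact m b); (y, bact m b')] ++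
       (tens_actseq b s ++ tens_actseq b' s))).
  by apply: tens_cat => //; rewrite bactDr; apply: tens_relDr.
change (tens_rel
  ([:: (y, bact m b)] ++
     ([:: (y, bact m b')] ++ (tens_actseq b s ++ tens_actseq b' s)))
  ([:: (y, bact m b)] ++
     (tens_actseq b s ++ ([:: (y, bact m b')] ++ tens_actseq b' s)))).
apply: tens_cat; first exact: tens_refl.
by rewrite !catA; apply: tens_cat; [apply: tens_catC | apply: tens_refl].
Qed.

HB.instance Definition _ := GRing.Zmodule_isLmodule.Build B^c tensor
  tens_scalerA tens_scale1r tens_scalerDr tens_scalerDl.

Lemma tensDl y y' m : tens (y + y') m = tens y m + tens y' m.
Proof.
by rewrite -[RHS]/(tens_add _ _) tens_addE; apply/tens_piE/tens_relDl.
Qed.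

Lemma tensDr y m m' : tens y (m + m') = tens y m + tens y m'.
Proof.
by rewrite -[RHS]/(tens_add _ _) tens_addE; apply/tens_piE/tens_relDr.
Qed.

Lemma tens_balanced y c m : tens (ract y c) m = tens y (c *: m).
Proof. exact/tens_piE/tens_relC. Qed.

Lemma tens_ract y m b : ract (tens y m : tensor) b = tens y (bact m b).
Proof. exact: tens_scaleE. Qed.

Lemma tens_lift (X : rmodType B) (g : Y -> M -> X) :
    (forall y y' m, g (y + y') m = g y m + g y' m) ->
    (forall y m m', g y (m + m') = g y m + g y m') ->
    (forall y c m, g (ract y c) m = g y (c *: m)) ->
    (forall y m b, g y (bact m b) = ract (g y m) b) ->
  exists f : {linear tensor -> X}, forall y m, f (tens y m) = g y m.
Proof.
move=> gDl gDr gC gB; pose G (s : seq (Y * M)) := \sum_(p <- s) g p.1 p.2.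
have G_rel s t : tens_rel s t -> G s = G t.
  elim=> {s t} //.
  - by move=> s t u _ -> _ ->.
  - by move=> s s' t t' _ ss' _ tt'; rewrite /G !big_cat /= -!/(G _) ss' tt'.
  - by move=> s t; rewrite /G !big_cat /= addrC.
  - move=> m; rewrite /G big_seq1 big_nil /=.
    by apply: (addrI (g 0 m)); rewrite -gDl !addr0.
  - by move=> y y' m; rewrite /G !big_cons !big_nil !addr0 /=.
  - by move=> y m m'; rewrite /G !big_cons !big_nil !addr0 /=.
  - by move=> y c m; rewrite /G !big_seq1 /=.
pose F (x : tensor) := G (repr x).
have FE s : F (\pi_tensor s) = G s by apply/G_rel/tens_repr.
have FD x y : F (x + y) = F x + F y.
  have [[s ->] [t ->]] := (tens_surj x, tens_surj y).
  by rewrite -[_ + _ in LHS]/(tens_add _ _) tens_addE !FE /G big_cat.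
have FZ b x : F (b *: x) = b *: F x.
  have [s ->] := tens_surj x.
  rewrite -[_ *: _ in LHS]/(tens_scale _ _) tens_scaleE !FE /G big_map scaler_sumr.
  by apply: eq_bigr => p _; rewrite gB.
have F_lin : linear F by move=> b x y; rewrite FD FZ.
pose Flin := GRing.isLinear.Build _ _ _ _ F F_lin.
pose FL : {linear tensor -> X} := HB.pack F Flin.
by exists FL => y m; rewrite /= FE /G big_seq1.
Qed.

End Tensor.

Section TripleModule.
Variables (k : fieldType) (C B : algebra k) (M : bimodule C B).
Variables (X : rmodType B) (Y : rmodType C) (f : {linear tensor Y M -> X}).

(* The right module over tri_alg M identified with the triple (X, Y)_f. *)
Definition triple : Type := let _ := f in (X * Y)%type.

HB.instance Definition _ := GRing.Zmodule.on triple.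

(* Row vector times matrix: (x, y) (b, 0; m, c) = (x b + f (y (x) m), y c). *)
Definition triple_scale (t : (tri_alg M)^c) (v : triple) : triple :=
  (ract v.1 t.1.1 + f (tens v.2 t.1.2), ract v.2 t.2).

Lemma triple_scalerA t u v :
  triple_scale t (triple_scale u v) = triple_scale (t * u) v.
Proof.
congr (_, _); rewrite /= /ract ?scalerA // scalerDr scalerA -addrA.
congr (_ + _); rewrite -linearZ -linearD; congr (f _).
by rewrite tensDr -tens_balanced -tens_ract.
Qed.

Lemma tens0r (y : Y) : tens y (0 : M) = 0.
Proof. by apply: (addrI (tens y (0 : M))); rewrite -tensDr !addr0. Qed.

Lemma triple_scale1r : left_id 1 triple_scale.
Proof.
by case=> x y; rewrite /triple_scale /= tens0r linear0 addr0 /ract !scale1r.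
Qed.

Lemma triple_scalerDr : right_distributive triple_scale +%R.
Proof.
move=> t [x y] [x' y']; congr (_, _); rewrite /= /ract scalerDr //.
by rewrite tensDl linearD addrACA.
Qed.

Lemma triple_scalerDl v : {morph triple_scale^~ v : t u / t + u}.
Proof.
move=> t u; congr (_, _); rewrite /= /ract scalerDl //.
by rewrite tensDr linearD addrACA.
Qed.

HB.instance Definition _ := GRing.Zmodule_isLmodule.Build (tri_alg M)^c triple
  triple_scalerA triple_scale1r triple_scalerDr triple_scalerDl.

End TripleModule.

Section Gluing.
Variables (k : fieldType) (C B : algebra k) (M : bimodule C B).

(* {(X, 0) | X in XX} *)
Definition lower_class (XX : modclass B) : modclass (tri_alg M) := fun V =>
  exists (X : rmodType B) (Y : rmodType C) (f : {linear tensor Y M -> X}),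
    [/\ XX X, zero_class Y & lin_iso V (triple f)].

(* {(X, Y)_f | X in mod B, Y in YY} *)
Definition upper_class (YY : modclass C) : modclass (tri_alg M) := fun V =>
  exists (X : rmodType B) (Y : rmodType C) (f : {linear tensor Y M -> X}),
    [/\ mod_class X, YY Y & lin_iso V (triple f)].

Definition glued_sequence (r : nat) (XX : nat -> modclass B)
    (YY : nat -> modclass C) : nat -> modclass (tri_alg M) := fun i =>
  if (i <= r)%N then lower_class (XX i) else upper_class (YY (i - r)%N).

End Gluing.

Arguments glued_sequence {k C B} M r XX YY.

(* Main.v *)
Require Import Defs.
From HB Require Import structures.
From mathcomp Require Import all_boot all_order all_algebra.
From mathcomp Require Import boolp.

(** Let e and e' be the two diagonal idempotents of A, with e A = B and
A e' = C inside A. For a right A-module V, the part V e is a submodule on which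
A acts through the projection A -> B, the quotient V / V e is V e' with A acting
through A -> C, and the triple of V is (V e, V e'). Both V |-> V e and
V |-> V e' are exact, and they preserve finite generation because C is
finite-dimensional and M is finitely generated, so that M is finitely generated
over B alone. Therefore the modules (X, Y)_f with X and Y in given torsion
classes form a torsion class [torsion_glue], the intersection of two inverse
images along exact functors [glueP]. This covers every class of the glued
sequence. The classes with X in mod B and Y = 0 are described in both ways, as
the last class of the first half and as the first class of the second half.

For the covering relations, let U be a torsion class between two consecutive
classes Z and Z' of the glued sequence. The B-modules X with (X, 0) in U, or in
the second half the C-modules Y with (0, Y) in U, form a torsion class between
two consecutive classes of the given sequence, hence equal to one of the two.
It remains to see that U is determined by this trace [covers_transfer]. In the
first half this holds because every V in Z' is equal to V e. In the second half
V e lies in Z, hence in U, so closure under quotients and under extensions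
applied to 0 -> V e -> V -> V e' -> 0 [tri_exact] shows that V is in U exactly
when (0, V e') is.

Inflation along A -> B and A -> C and the two functors V |-> V e and
V |-> V e' are all instances of one construction: a map s : R -> S preserving
sums and products, but perhaps not 1, sends a right S-module V to the right
R-module V s(1) [corner]. *)

Set Implicit Arguments.
Unset Strict Implicit.
Unset Printing Implicit Defensive.

Import GRing.Theory.
Local Open Scope ring_scope.

(** * Right actions, isomorphisms and generators *)

Section RightAction.
Variables (R : pzRingType) (V : rmodType R).
Implicit Types (v : V) (a b : R).

Lemma ractM v a b : ract v (a * b) = ract (ract v a) b.
Proof. by rewrite /ract scalerA. Qed.

Lemma ract1 v : ract v 1 = v.
Proof. exact: scale1r. Qed.

Lemma ract0 v : ract v 0 = 0.
Proof. exact: scale0r. Qed.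

Lemma ractDr v a b : ract v (a + b) = ract v a + ract v b.
Proof. exact: scalerDl. Qed.

Lemma ractDl v w a : ract (v + w) a = ract v a + ract w a.
Proof. exact: scalerDr. Qed.

Lemma ractBl v w a : ract (v - w) a = ract v a - ract w a.
Proof. exact: scalerBr. Qed.

Lemma ract0l a : ract (0 : V) a = 0.
Proof. exact: scaler0. Qed.

Lemma ract_suml (I : finType) (F : I -> V) a :
  ract (\sum_i F i) a = \sum_i ract (F i) a.
Proof. exact: scaler_sumr. Qed.

Lemma ract_sumr (I : finType) v (F : I -> R) :
  ract v (\sum_i F i) = \sum_i ract v (F i).
Proof. exact: (@scaler_suml _ _ v _ _ predT (F : I -> R^c)). Qed.

End RightAction.

Lemma linear_ract (R : pzRingType) (V W : rmodType R) (f : {linear V -> W})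
    (v : V) (a : R) :
  f (ract v a) = ract (f v) a.
Proof. exact: linearZ. Qed.

Lemma linear_of_ract (R : pzRingType) (V W : rmodType R) (f : V -> W) :
    {morph f : v w / v + w} -> (forall v a, f (ract v a) = ract (f v) a) ->
  {F : {linear V -> W} | F =1 f}.
Proof.
move=> fD fZ; have fL : linear f by move=> a v w; rewrite fD -!/(ract _ a) fZ.
pose fM := GRing.isLinear.Build _ _ _ _ f fL.
by exists (HB.pack f fM : {linear V -> W}).
Qed.

Lemma lin_iso_sym (R : pzRingType) (V W : lmodType R) :
  lin_iso V W -> lin_iso W V.
Proof.
case=> f [g fK gK].
have gL : linear g by apply: (can2_linear fK gK).
pose gM := GRing.isLinear.Build _ _ _ _ g gL.
by exists (HB.pack g gM : {linear W -> V}), f.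
Qed.

Lemma inj_surj_lin_iso (R : pzRingType) (V W : lmodType R)
    (f : {linear V -> W}) :
  injective f -> (forall w, exists v, f v = w) -> lin_iso V W.
Proof.
move=> f_inj /choice[g gK]; exists f; exists g => // v.
by apply: f_inj; rewrite gK.
Qed.

Lemma direct_sum_exact (R : pzRingType) (V W : rmodType R) :
  exists (i : {linear V -> (V * W)%type}) (p : {linear (V * W)%type -> W}),
    [/\ injective i, forall w, exists v, p v = w
      & forall v, p v = 0 <-> exists u, i u = v].
Proof.
have [i iE] : {i : {linear V -> (V * W)%type} | i =1 (fun v => (v, 0))}.
  apply: linear_of_ract => [v w|v a]; congr (_, _); first by rewrite addr0.
  exact/esym/ract0l.
have [p pE] : {p : {linear (V * W)%type -> W} | p =1 snd}.
  exact: linear_of_ract.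
exists i, p; split=> [v v'|w|[v w]]; first by rewrite !iE => -[].
  by exists (0, w); rewrite pE.
rewrite pE /=; split=> [->|[v']]; first by exists v; rewrite iE.
by rewrite iE => -[].
Qed.

Lemma torsion_iso (R : pzRingType) (T : modclass R) (V W : rmodType R) :
  torsion_class T -> lin_iso V W -> T V -> T W.
Proof.
move=> tT [f [g fK gK]]; apply: (torsion_image tT (p := f)) => w.
by exists (g w).
Qed.

Lemma fin_gen_family (R : pzRingType) (V : lmodType R) (I : finType)
    (g : I -> V) :
  (forall v, exists c : I -> R, v = \sum_i c i *: g i) -> fin_gen V.
Proof.
move=> g_gen; exists #|I|, (g \o enum_val) => v.
have [c ->] := g_gen v; exists (c \o enum_val).
by rewrite (reindex _ (onW_bij predT (enum_val_bij I))).
Qed.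

(** * The smallest and the largest torsion class *)

Section BasicTorsionClasses.
Variable R : pzRingType.

Lemma zero_class_fin_gen : class_sub (@zero_class R) (@mod_class R).
Proof.
move=> V V0; exists 0%N, (fun=> 0) => v; exists (fun=> 0).
by rewrite big_ord0.
Qed.

Lemma torsion_zero_class : torsion_class (@zero_class R).
Proof.
split=> [||V W p p_surj V0 w|V W V0 W0 [v w]|U V W i p _ _ ker U0 W0 v] //.
- exact: zero_class_fin_gen.
- by have [v <-] := p_surj w; rewrite (V0 v) linear0.
- by rewrite (V0 v) (W0 w).
- by have [[//|u <-] _] := ker v; rewrite (U0 u) linear0.
Qed.

Lemma fin_gen_ext (U V W : rmodType R) (i : {linear U -> V})
    (p : {linear V -> W}) :
    (forall w, exists v, p v = w) ->
    (forall v, p v = 0 -> exists u, i u = v) ->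
  fin_gen U -> fin_gen W -> fin_gen V.
Proof.
move=> /choice[q qK] ker [n [g g_gen]] [m [h h_gen]].
apply: (@fin_gen_family _ _ ('I_n + 'I_m)%type
  (fun x => match x with inl j => i (g j) | inr j => q (h j) end)) => v.
have [d dE] := h_gen (p v).
have [|u uE] := ker (v - \sum_j d j *: q (h j)).
  apply/eqP; rewrite linearB subr_eq0 linear_sum dE; apply/eqP.
  by apply: eq_bigr => j _; rewrite linearZ /= qK.
have [c cE] := g_gen u.
exists (fun x => match x with inl j => c j | inr j => d j end).
rewrite big_sumType /= -[LHS](subrK (\sum_j d j *: q (h j))) -uE cE linear_sum.
by congr (_ + _); apply: eq_bigr => j _; rewrite linearZ.
Qed.

Lemma torsion_mod_class : torsion_class (@mod_class R).
Proof.
split=> [||V W p p_surj [n [g g_gen]]|V W Vf Wf|U V W i p _ p_surj ker] //.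
- exact: zero_class_fin_gen.
- exists n, (p \o g) => w; have [v <-] := p_surj w.
  have [c ->] := g_gen v; exists c; rewrite linear_sum.
  by apply: eq_bigr => j _; rewrite linearZ.
- have [i [p [_ p_surj ker]]] := direct_sum_exact V W.
  by apply: (fin_gen_ext p_surj (i := i)) => // v /ker.
- by apply: (fin_gen_ext p_surj (i := i)) => // v /ker.
Qed.

End BasicTorsionClasses.

(** * The module V s(1) of a non-unital ring morphism s *)

(** Preserving 1 is not required, so as to include the inclusions of the diagonal
blocks into a matrix ring, which send 1 to an idempotent. *)
Record nuhom (R S : pzRingType) := NuHom {
  nuhom_fun :> R -> S;
  nuhomD : {morph nuhom_fun : a b / a + b};
  nuhomM : {morph nuhom_fun : a b / a * b}
}.

Section Corner.
Variables (R S : pzRingType) (s : nuhom R S).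

Section Module.
Variable V : rmodType S.

(** As s(1) is idempotent, the multiples of s(1) are the vectors it fixes. *)
Definition corner_pred : {pred V} := fun v => ract v (s 1) == v.

Fact corner_zmod_closed : zmod_closed corner_pred.
Proof.
split=> [|v w]; rewrite !unfold_in; first by rewrite ract0l.
by rewrite ractBl => /eqP-> /eqP->.
Qed.

HB.instance Definition _ :=
  GRing.isZmodClosed.Build V corner_pred corner_zmod_closed.

Definition corner : Type := {v : V | v \in corner_pred}.

HB.instance Definition _ := SubType.on corner.
HB.instance Definition _ := [Choice of corner by <:].
HB.instance Definition _ := [SubChoice_isSubZmodule of corner by <:].

(** A single name for the inclusion of [corner] into V: the instances of [val]
found at different points of the hierarchy are convertible but do not match
each other in rewriting. *)
Definition cval (v : corner) : V := val v.

Lemma cval_inj : injective cval.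
Proof. exact: val_inj. Qed.

Lemma cvalD (v w : corner) : cval (v + w) = cval v + cval w.
Proof. by []. Qed.

Lemma corner_fixed (v : corner) : ract (cval v) (s 1) = cval v.
Proof. exact/eqP/(valP v). Qed.

Fact corner_proj_subproof (v : V) : ract v (s 1) \in corner_pred.
Proof. by rewrite unfold_in -ractM -nuhomM mulr1. Qed.

(** Locked here and in [corner_scale], so that unification does not see an
action through s as a product with s(1), or conversely. *)
Definition corner_proj (v : V) : corner :=
  locked (exist _ (ract v (s 1)) (corner_proj_subproof v)).

Lemma cval_proj v : cval (corner_proj v) = ract v (s 1).
Proof. by rewrite /corner_proj -lock. Qed.

Definition corner_scale (a : R^c) (v : corner) : corner :=
  locked (corner_proj (ract (cval v) (s a))).

Lemma cval_scale a v : cval (corner_scale a v) = ract (cval v) (s a).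
Proof.
by rewrite /corner_scale -lock cval_proj -ractM -nuhomM mulr1.
Qed.

Fact corner_scalerA a b v :
  corner_scale a (corner_scale b v) = corner_scale (a * b) v.
Proof. by apply: cval_inj; rewrite !cval_scale -ractM -nuhomM. Qed.

Fact corner_scale1r : left_id 1 corner_scale.
Proof. by move=> v; apply: cval_inj; rewrite cval_scale corner_fixed. Qed.

Fact corner_scalerDr : right_distributive corner_scale +%R.
Proof.
by move=> a v w; apply: cval_inj; rewrite cvalD !cval_scale ractDl.
Qed.

Fact corner_scalerDl v : {morph corner_scale^~ v : a b / a + b}.
Proof.
move=> a b; apply: cval_inj.
by rewrite cvalD !cval_scale nuhomD ractDr.
Qed.

HB.instance Definition _ := GRing.Zmodule_isLmodule.Build R^c corner
  corner_scalerA corner_scale1r corner_scalerDr corner_scalerDl.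

Lemma cval_ract (v : corner) a : cval (ract v a) = ract (cval v) (s a).
Proof. exact: cval_scale. Qed.

Lemma cval_sum (I : finType) (F : I -> corner) :
  cval (\sum_i F i) = \sum_i cval (F i).
Proof. exact: raddf_sum. Qed.

End Module.

Arguments cval {V} v.

Lemma corner_map_ex (V W : rmodType S) (f : {linear V -> W}) :
  {F : {linear corner V -> corner W} | forall v, cval (F v) = f (cval v)}.
Proof.
pose h (v : corner V) := corner_proj (f (cval v)).
have fE v : cval (h v) = f (cval v).
  by rewrite cval_proj -linear_ract corner_fixed.
have [||F FE] := @linear_of_ract _ (corner V) (corner W) h.
- by move=> v w; apply: cval_inj; rewrite cvalD !fE linearD.
- move=> v a; apply: cval_inj.
  by rewrite cval_ract !fE cval_ract linear_ract.
- by exists F => v; rewrite FE fE.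
Qed.

Lemma corner_surj (V W : rmodType S) (f : {linear V -> W})
    (F : {linear corner V -> corner W}) :
    (forall v, cval (F v) = f (cval v)) ->
    (forall w, exists v, f v = w) ->
  forall w, exists v, F v = w.
Proof.
move=> FE f_surj w; have [v vE] := f_surj (cval w); exists (corner_proj v).
by apply: cval_inj; rewrite FE cval_proj linear_ract vE corner_fixed.
Qed.

(** The inverse image of a torsion class along an exact functor is closed under
quotients, sums and extensions; finite generation has to be imposed apart. *)
Lemma torsion_pullback (T : modclass R) :
    torsion_class T ->
  torsion_class (fun V : rmodType S => fin_gen V /\ T (corner V)).
Proof.
move=> tT; have tM := torsion_mod_class S.
have T_ext (U V W : rmodType S) (i : {linear U -> V}) (p : {linear V -> W}) :
    injective i -> (forall w, exists v, p v = w) ->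
    (forall v, p v = 0 <-> exists u, i u = v) ->
  T (corner U) -> T (corner W) -> T (corner V).
  have [[I IE] [P PE]] := (corner_map_ex i, corner_map_ex p).
  move=> i_inj p_surj ker; apply: (torsion_ext tT (i := I) (p := P)).
  - by move=> u v /(congr1 cval); rewrite !IE => /i_inj/cval_inj.
  - exact: corner_surj PE p_surj.
  - move=> v; split=> [/(congr1 cval)|[u <-]]; last first.
      by apply: cval_inj; rewrite PE IE; apply/ker; exists (cval u).
    rewrite PE => /ker[u uE]; exists (corner_proj u); apply: cval_inj.
    by rewrite IE cval_proj linear_ract uE corner_fixed.
split=> [V []|V V0|V W p p_surj [Vf TV]|V W [Vf TV] [Wf TW]|].
- by [].
- split; first exact: zero_class_fin_gen.
  apply: (torsion_zero tT) => v; apply: cval_inj.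
  by rewrite (V0 (cval v)).
- split; first exact: (torsion_image tM p_surj).
  have [P PE] := corner_map_ex p.
  exact: (torsion_image tT (p := P)) (corner_surj PE p_surj) TV.
- split; first exact: (torsion_sum tM).
  have [i [p [i_inj p_surj ker]]] := direct_sum_exact V W.
  exact: (T_ext V _ W i p).
- move=> U V W i p i_inj p_surj ker [Uf TU] [Wf TW].
  split; first exact: (torsion_ext tM i_inj p_surj ker).
  exact: (T_ext U V W i p).
Qed.

(** If the g_i generate V over S and the a_j generate S s(1) over R, then the
g_i a_j generate V s(1) over R. *)
Lemma corner_fin_gen (J : finType) (a : J -> S) :
    (forall x, exists c : J -> R, x * s 1 = \sum_j a j * s (c j)) ->
  forall V : rmodType S, fin_gen V -> fin_gen (corner V).
Proof.
move=> /choice[d dE] V [n [g g_gen]].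
apply: (@fin_gen_family _ (corner V) ('I_n * J)%type
  (fun ij => corner_proj (ract (g ij.1) (a ij.2)))) => v.
have [c cE] := g_gen (cval v); exists (fun ij => d (c ij.1) ij.2).
apply: cval_inj; rewrite cval_sum -corner_fixed cE.
rewrite -(pair_bigA _ (fun i j =>
  cval (ract (corner_proj (ract (g i) (a j))) (d (c i) j)))) /=.
rewrite ract_suml; apply: eq_bigr => i _.
rewrite -[c i *: g i]/(ract (g i) (c i)) -ractM dE ract_sumr.
apply: eq_bigr => j _.
by rewrite cval_ract cval_proj -!ractM -nuhomM mul1r.
Qed.

End Corner.

Arguments cval {R S s V} v.

Lemma lin_iso_corner (R S : pzRingType) (s : nuhom R S) (V W : rmodType S) :
  lin_iso V W -> lin_iso (corner s V) (corner s W).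
Proof.
case=> f [g fK gK]; have [F FE] := corner_map_ex s f.
apply: (inj_surj_lin_iso (f := F)).
  by move=> v w /(congr1 cval); rewrite !FE => /(can_inj fK)/cval_inj.
by apply: corner_surj FE _ => w; exists (g w).
Qed.

Lemma surj_corner_fin_gen (R S : pzRingType) (s : nuhom R S) :
    (forall x, exists c, s c = x) ->
  forall V : rmodType S, fin_gen V -> fin_gen (corner s V).
Proof.
move=> s_surj V; apply: (corner_fin_gen (a := fun _ : 'I_1 => 1)) => x.
have [c cE] := s_surj (x * s 1); exists (fun=> c).
by rewrite big_ord1 mul1r cE.
Qed.

Lemma torsion_meet (R : pzRingType) (S T : modclass R) :
  torsion_class S -> torsion_class T -> torsion_class (fun V => S V /\ T V).
Proof.
move=> tS tT; split=> [V [/(torsion_mod tS)]|V V0|V W p p_surj [SV TV]||] //.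
- by split; [apply: (torsion_zero tS) | apply: (torsion_zero tT)].
- by split; [apply: (torsion_image tS p_surj)
           | apply: (torsion_image tT p_surj)].
- by move=> V W [SV TV] [SW TW];
    split; [apply: (torsion_sum tS) | apply: (torsion_sum tT)].
- move=> U V W i p i_inj p_surj ker [SU TU] [SW TW].
  by split; [apply: (torsion_ext tS i_inj p_surj ker)
           | apply: (torsion_ext tT i_inj p_surj ker)].
Qed.

Lemma class_eqP (R : pzRingType) (S T : modclass R) : class_eq S T -> S = T.
Proof. by move=> ST; apply/funext => V; apply/propext/ST. Qed.

(** * Inflation along a retraction *)

Section Inflation.
Variables (R S : pzRingType) (i : nuhom R S) (p : nuhom S R).
Hypothesis pi1 : p 1 = 1.
Local Notation inflate X := (corner p X).
Local Notation restrict V := (corner i V).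

Lemma restrict_inflate : cancel i p ->
  forall X : rmodType R, lin_iso (restrict (inflate X)) X.
Proof.
move=> ipK X.
have [||f fE] := @linear_of_ract _ (restrict (inflate X)) X
  (fun v => cval (cval v)).
- by move=> v w; rewrite !cvalD.
- by move=> v a; rewrite !cval_ract ipK.
apply: (inj_surj_lin_iso (f := f)) => [v w|x].
  by rewrite !fE => /cval_inj/cval_inj.
exists (corner_proj i (corner_proj p x)).
by rewrite fE cval_proj cval_ract cval_proj -!ractM pi1
  ipK !mulr1 ract1.
Qed.

(** The hypothesis says that the subspace V i(1) is stable under S, and that S
acts on it through p. *)
Lemma inflate_restrict_inj (V : rmodType S) :
    (forall a, i 1 * a = i (p a)) ->
  exists f : {linear inflate (restrict V) -> V}, forall v, f v = cval (cval v).
Proof.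
move=> ipE.
have [||f fE] := @linear_of_ract _ (inflate (restrict V)) V
  (fun v => cval (cval v)).
- by move=> v w; rewrite !cvalD.
- by move=> v a; rewrite !cval_ract -ipE ractM corner_fixed.
by exists f.
Qed.

(** Dually, right multiplication by i(1) is S-linear for the action through
p on its image. *)
Lemma inflate_restrict_surj (V : rmodType S) :
    (forall a, a * i 1 = i (p a)) ->
  exists f : {linear V -> inflate (restrict V)},
    forall v, cval (cval (f v)) = ract v (i 1).
Proof.
move=> ipE.
pose h v : inflate (restrict V) := corner_proj p (corner_proj i v).
have fE v : cval (cval (h v)) = ract v (i 1).
  by rewrite cval_proj cval_ract cval_proj -ractM pi1
    -nuhomM mulr1.
have [||f fE'] := @linear_of_ract _ V (inflate (restrict V)) h.
- by move=> v w; do 2!apply: cval_inj; rewrite !cvalD !fE ractDl.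
- move=> v a; do 2!apply: cval_inj.
  rewrite fE !cval_ract fE -!ractM; congr (ract _ _).
  by rewrite ipE -nuhomM mul1r.
by exists f => v; rewrite fE' fE.
Qed.

End Inflation.

Lemma restrict_inflate0 (Q R S : pzRingType) (i : nuhom Q S) (p : nuhom S R) :
    (forall a, p (i a) = 0) ->
  forall X : rmodType R, zero_class (corner i (corner p X)).
Proof.
move=> pi0 X v; do 2!apply: cval_inj.
by rewrite -(corner_fixed v) cval_ract pi0 ract0.
Qed.

(** * Transfer of covering relations *)

(** The last hypothesis makes a torsion class U between Z and Z' determined by
its trace, the class of the R-modules whose inflation is in U. The trace lies
between X and X', so it is one of them; the hypothesis is used for U, and for
Z and Z' themselves in order to recognize U from its trace. *)
Lemma covers_transfer (R S : pzRingType) (i : nuhom R S) (p : nuhom S R)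
    (X X' : modclass R) (Z Z' : modclass S) :
    torsion_class X -> torsion_class X' ->
    torsion_class Z -> torsion_class Z' -> class_sub Z Z' ->
    (forall V, X V <-> Z (corner p V)) ->
    (forall V, X' V <-> Z' (corner p V)) ->
    (forall U, torsion_class U -> class_sub Z U -> class_sub U Z' ->
       forall V, Z' V -> (U V <-> U (corner p (corner i V)))) ->
  covers X X' -> covers Z Z'.
Proof.
move=> tX tX' tZ tZ' ZZ' XZ XZ' loc [XX' neqX maxX].
split=> // [eqZ|U tU ZU UZ'].
  by apply: neqX => V; rewrite XZ XZ'; apply: eqZ.
pose T (V : rmodType R) := fin_gen V /\ U (corner p V).
have XT : class_sub X T.
  by move=> V XV; split; [apply: torsion_mod tX _ XV | apply/ZU/XZ].
have TX' : class_sub T X' by move=> V [_ /UZ' /XZ'].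
case: (maxX T (torsion_pullback p tU) XT TX') => eqT; [left | right] => V.
  split=> [UV|]; last exact: ZU.
  have Z'V := UZ' _ UV; apply/(loc Z tZ) => //; apply/XZ/eqT.
  have UV' := (loc U tU ZU UZ' V Z'V).1 UV; split=> //.
  exact/(torsion_mod tX')/XZ'/UZ'.
split=> [|Z'V]; first exact: UZ'.
apply/(loc U tU ZU UZ' V Z'V).
by have /XZ'/eqT[] := (loc Z' tZ' ZZ' (fun _ => id) V Z'V).1 Z'V.
Qed.

(** * The bimodule as a right module *)

(** If the e_i span C over k and the g_j generate M as a bimodule, the e_i g_j
generate M over B, since scalars of k can be moved across to B. *)
Lemma bimod_fin_gen_right (k : fieldType) (B C : algebra k)
    (M : bimodule C B) :
    fin_dim C -> bimod_fin_gen M ->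
  exists (J : finType) (h : J -> M), forall m,
    exists c : J -> B, m = \sum_j bact (h j) (c j).
Proof.
move=> [q [e e_gen]] [n [g g_gen]].
pose h (ij : 'I_q * 'I_n) := e ij.1 *: g ij.2.
exists ('I_q * 'I_n)%type, h.
pose span m := exists c : 'I_q * 'I_n -> B, m = \sum_ij bact (h ij) (c ij).
have span0 : span 0.
  by exists (fun=> 0); rewrite big1 // => ij _; rewrite bact0r.
have spanD m m' : span m -> span m' -> span (m + m').
  case=> [c ->] [c' ->]; exists (fun ij => c ij + c' ij).
  by rewrite -big_split; apply: eq_bigr => ij _; rewrite bactDr.
have span1 ij b : span (bact (h ij) b).
  exists (fun ij' => if ij' == ij then b else 0).
  rewrite (bigD1 ij) //= eqxx big1 ?addr0 // => ij' /negPf->.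
  by rewrite bact0r.
move=> m; have [p [j [c [b ->]]]] := g_gen m.
apply: (big_ind span) => // l _; have [a ->] := e_gen (c l).
rewrite scaler_suml; apply: (big_ind span) => // t _.
rewrite -scalerA -bactC -bact_central -bactM.
exact: (span1 (t, j l)).
Qed.

(** * Modules over the triangular matrix algebra *)

Section TriangularModules.
Variables (k : fieldType) (B C : algebra k) (M : bimodule C B).
Local Notation A := (tri_alg M).

Let simpl0 := (mulr0, mul0r, mulr1, mul1r, @bact1 _ _ _ M, @bact0r _ _ _ M,
  @bact0l _ _ _ M, scaler0, scale0r, scale1r, addr0, add0r).

Fact tri_inB_subproof :
  {morph (fun b : B => (b, 0, 0) : A) : b b' / b + b'} *
  {morph (fun b : B => (b, 0, 0) : A) : b b' / b * b'}.
Proof. by split=> b b'; congr (_, _, _); rewrite /= ?simpl0. Qed.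

Definition tri_inB : nuhom B A :=
  NuHom tri_inB_subproof.1 tri_inB_subproof.2.

Fact tri_inC_subproof :
  {morph (fun c : C => (0, 0, c) : A) : c c' / c + c'} *
  {morph (fun c : C => (0, 0, c) : A) : c c' / c * c'}.
Proof. by split=> c c'; congr (_, _, _); rewrite /= ?simpl0. Qed.

Definition tri_inC : nuhom C A :=
  NuHom tri_inC_subproof.1 tri_inC_subproof.2.

Definition tri_prB : nuhom A B :=
  @NuHom A B (fun a => a.1.1) (fun _ _ => erefl) (fun _ _ => erefl).

Definition tri_prC : nuhom A C :=
  @NuHom A C (fun a => a.2) (fun _ _ => erefl) (fun _ _ => erefl).

Definition tri_inM (m : M) : A := (0, m, 0).

Lemma tri_inBE (a : A) : tri_inB 1 * a = tri_inB (tri_prB a).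
Proof. by congr (_, _, _); rewrite /= ?simpl0. Qed.

Lemma tri_inCE (a : A) : a * tri_inC 1 = tri_inC (tri_prC a).
Proof. by congr (_, _, _); rewrite /= ?simpl0. Qed.

Lemma tri_in1 : tri_inB 1 + tri_inC 1 = 1.
Proof. by congr (_, _, _); rewrite /= ?simpl0. Qed.

Lemma tri_inBC b c : tri_inB b * tri_inC c = 0.
Proof. by congr (_, _, _); rewrite /= ?simpl0. Qed.

Lemma tri_inCB b c : tri_inC c * tri_inB b = 0.
Proof. by congr (_, _, _); rewrite /= ?simpl0. Qed.

Lemma tri_inC_fin_gen (V : rmodType A) :
  fin_gen V -> fin_gen (corner tri_inC V).
Proof.
apply: (corner_fin_gen (a := fun _ : 'I_1 => tri_inC 1)) => x.
exists (fun=> tri_prC x).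
by rewrite big_ord1 tri_inCE -nuhomM mul1r.
Qed.

(** A e consists of the matrices with rows (b, 0) and (m, 0): over B it is
generated by e and by generators of M. *)
Lemma tri_inB_fin_gen (hC : fin_dim C) (hM : bimod_fin_gen M)
    (V : rmodType A) :
  fin_gen V -> fin_gen (corner tri_inB V).
Proof.
have [J [h h_gen]] := bimod_fin_gen_right hC hM.
apply: (corner_fin_gen (J := ('I_1 + J)%type)
  (a := fun x => match x with inl _ => tri_inB 1 | inr j => tri_inM (h j) end)).
move=> [[b m] c]; have [d ->] := h_gen m.
exists (fun x => match x with inl _ => b | inr j => d j end).
rewrite big_sumType big_ord1 -nuhomM mul1r /=.
have -> : \sum_j tri_inM (h j) * tri_inB (d j)
    = tri_inM (\sum_j bact (h j) (d j)) :> A.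
  apply/esym; elim/big_rec2: _ => // j a m' _ <-.
  by congr (_, _, _); rewrite /= ?simpl0.
by congr (_, _, _); rewrite /= ?simpl0.
Qed.

(** The exact sequence 0 -> V e -> V -> V e' -> 0, in which A acts on the ends
through B and through C. *)
Lemma tri_exact (V : rmodType A) :
  exists (j : {linear corner tri_prB (corner tri_inB V) -> V})
      (q : {linear V -> corner tri_prC (corner tri_inC V)}),
    [/\ injective j, forall w, exists v, q v = w
      & forall v, q v = 0 <-> exists u, j u = v].
Proof.
have [j jE] := inflate_restrict_inj V tri_inBE.
have [q qE] := inflate_restrict_surj (erefl : tri_prC 1 = 1) V tri_inCE.
have qv0 v : q v = 0 <-> ract v (tri_inC 1) = 0.
  by rewrite -qE; split=> [->|v0] //; do 2!apply: cval_inj.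
exists j, q; split=> [u u'|w|v].
- by rewrite !jE => /cval_inj/cval_inj.
- by exists (cval (cval w)); do 2!apply: cval_inj; rewrite qE corner_fixed.
split=> [/qv0 v0|[u <-]]; last first.
  by apply/qv0; rewrite jE -(corner_fixed (cval u)) -ractM tri_inBC ract0.
exists (corner_proj _ (corner_proj _ v)).
rewrite jE cval_proj cval_ract cval_proj -ractM -nuhomM mul1r.
(* v = v e + v e', and here v e' = 0. *)
rewrite (_ : tri_prB 1 = 1) //.
by have := ract1 v; rewrite -tri_in1 ractDr v0 addr0.
Qed.

Lemma tri_fin_gen (V : rmodType A) :
  fin_gen (corner tri_inB V) -> fin_gen (corner tri_inC V) -> fin_gen V.
Proof.
move=> fB fC; have [j [q [_ q_surj ker]]] := tri_exact V.
apply: (fin_gen_ext q_surj (i := j)) => [v /ker||] //.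
  by apply: surj_corner_fin_gen fB => b; exists (tri_inB b).
by apply: surj_corner_fin_gen fC => c; exists (tri_inC c).
Qed.

(** * Modules as triples *)

Section Triple.
Variables (X : rmodType B) (Y : rmodType C) (f : {linear tensor Y M -> X}).

Lemma ract_triple (v : triple f) (a : A) :
  ract v a = (ract v.1 a.1.1 + f (tens v.2 a.1.2), ract v.2 a.2).
Proof. by []. Qed.

Lemma triple_inB : lin_iso (corner tri_inB (triple f)) X.
Proof.
have EB (v : triple f) b : ract v (tri_inB b) = (ract v.1 b, 0).
  by rewrite ract_triple /= tens0r linear0 addr0 ract0.
have [||g gE] := @linear_of_ract _ (corner tri_inB (triple f)) X
  (fun v => (cval v).1).
- by move=> v w; rewrite cvalD.
- by move=> v b; rewrite cval_ract EB.
apply: (inj_surj_lin_iso (f := g)) => [v w|x].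
  rewrite !gE => vw; apply: cval_inj.
  by rewrite -(corner_fixed v) -(corner_fixed w) !EB vw.
exists (corner_proj tri_inB ((x, 0) : triple f)).
by rewrite gE cval_proj EB /= ract1.
Qed.

Lemma triple_inC : lin_iso (corner tri_inC (triple f)) Y.
Proof.
have EC (v : triple f) c : ract v (tri_inC c) = (0, ract v.2 c).
  by rewrite ract_triple /= tens0r linear0 addr0 ract0.
have [||g gE] := @linear_of_ract _ (corner tri_inC (triple f)) Y
  (fun v => (cval v).2).
- by move=> v w; rewrite cvalD.
- by move=> v b; rewrite cval_ract EC.
apply: (inj_surj_lin_iso (f := g)) => [v w|y].
  rewrite !gE => vw; apply: cval_inj.
  by rewrite -(corner_fixed v) -(corner_fixed w) !EC vw.
exists (corner_proj tri_inC ((0, y) : triple f)).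
by rewrite gE cval_proj EC /= ract1.
Qed.

End Triple.

(** The structure map of the triple of V is y (x) m |-> y m, the product with
the matrix whose only entry is m; it sends V e' to V e. *)
Lemma triple_corners (V : rmodType A) :
  exists f : {linear tensor (corner tri_inC V) M -> corner tri_inB V},
    lin_iso V (triple f).
Proof.
have [||||f fE] := @tens_lift k C B (corner tri_inC V) M (corner tri_inB V)
  (fun y m => corner_proj tri_inB (ract (cval y) (tri_inM m))).
- move=> y y' m; apply: cval_inj.
  by rewrite !cvalD !cval_proj !ractDl.
- move=> y m m'; apply: cval_inj.
  rewrite cvalD !cval_proj -ractDl -ractDr.
  by congr (ract (ract _ _) _); congr (_, _, _); rewrite /= ?simpl0.
- move=> y c m; apply: cval_inj.
  rewrite !cval_proj cval_ract -!ractM.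
  by congr (ract _ _); congr (_, _, _); rewrite /= ?simpl0.
- move=> y m b; apply: cval_inj.
  rewrite cval_ract !cval_proj -!ractM.
  by congr (ract _ _); congr (_, _, _); rewrite /= ?simpl0.
exists f.
pose h v : triple f := (corner_proj tri_inB v, corner_proj tri_inC v).
have [||g gE] := @linear_of_ract A V (triple f) h.
- move=> v w; congr (_, _); apply: cval_inj;
  by rewrite cvalD !cval_proj ractDl.
- move=> v a; rewrite ract_triple; congr (_, _); apply: cval_inj.
    rewrite cvalD cval_ract fE !cval_proj -!ractM -ractDr.
    by congr (ract _ _); congr (_, _, _); rewrite /= ?simpl0.
  rewrite cval_ract !cval_proj -!ractM; congr (ract _ _).
  by rewrite tri_inCE -nuhomM mul1r.
apply: (inj_surj_lin_iso (f := g)) => [v w|[x y]].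
  rewrite !gE => -[/(congr1 cval) vwB /(congr1 cval) vwC].
  rewrite !cval_proj in vwB vwC.
  by rewrite -[v]ract1 -[w]ract1 -tri_in1 !ractDr vwB vwC.
exists (cval x + cval y); rewrite gE.
congr (_, _); apply: cval_inj; rewrite cval_proj ractDl.
  by rewrite -(corner_fixed y) -ractM tri_inCB ract0 addr0 corner_fixed.
by rewrite -(corner_fixed x) -ractM tri_inBC ract0 add0r corner_fixed.
Qed.

(** * Gluing torsion classes *)

(** The common form of [lower_class], where YY is the zero class, and
[upper_class], where XX is mod B; both are convertible to it. *)
Definition glue (XX : modclass B) (YY : modclass C) : modclass A := fun V =>
  exists (X : rmodType B) (Y : rmodType C) (f : {linear tensor Y M -> X}),
    [/\ XX X, YY Y & lin_iso V (triple f)].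

Section Glue.
Variables (XX : modclass B) (YY : modclass C).
Hypotheses (tX : torsion_class XX) (tY : torsion_class YY).

(** Being determined by V up to isomorphism, the triple may be taken to be
(V e, V e'). *)
Lemma glueP (V : rmodType A) :
  glue XX YY V <-> XX (corner tri_inB V) /\ YY (corner tri_inC V).
Proof.
split=> [[X [Y [f [XXX YYY Vf]]]]|[XV YV]]; last first.
  have [f Vf] := triple_corners V.
  by exists (corner tri_inB V), (corner tri_inC V), f.
split.
  apply: torsion_iso (lin_iso_sym (lin_iso_corner _ Vf)) _ => //.
  exact: torsion_iso (lin_iso_sym (triple_inB f)) XXX.
apply: torsion_iso (lin_iso_sym (lin_iso_corner _ Vf)) _ => //.
exact: torsion_iso (lin_iso_sym (triple_inC f)) YYY.
Qed.

Lemma torsion_glue : torsion_class (glue XX YY).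
Proof.
have tB := torsion_pullback tri_inB tX.
have := torsion_meet tB (torsion_pullback tri_inC tY).
congr torsion_class; apply: class_eqP => V; rewrite glueP.
split=> [[[_ XV] [_ YV]]|[XV YV]] //.
have Vf : fin_gen V.
  by apply: tri_fin_gen; [apply: (torsion_mod tX) | apply: (torsion_mod tY)].
by [].
Qed.

End Glue.

Lemma glue_sub (XX XX' : modclass B) (YY YY' : modclass C) :
  class_sub XX XX' -> class_sub YY YY' -> class_sub (glue XX YY) (glue XX' YY').
Proof.
move=> sX sY V [X [Y [f [XXX YYY Vf]]]]; exists X, Y, f.
by split; [apply: sX | apply: sY |].
Qed.

Lemma glue_inflateB (XX : modclass B) (YY : modclass C) (X : rmodType B) :
    torsion_class XX -> torsion_class YY ->
  XX X <-> glue XX YY (corner tri_prB X).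
Proof.
move=> tX tY; rewrite glueP //.
have iX : lin_iso (corner tri_inB (corner tri_prB X)) X.
  exact: restrict_inflate.
split=> [XXX|[XXX _]]; last exact: torsion_iso iX XXX.
split; first exact: torsion_iso (lin_iso_sym iX) XXX.
exact/(torsion_zero tY)/restrict_inflate0.
Qed.

Lemma glue_inflateC (XX : modclass B) (YY : modclass C) (Y : rmodType C) :
    torsion_class XX -> torsion_class YY ->
  YY Y <-> glue XX YY (corner tri_prC Y).
Proof.
move=> tX tY; rewrite glueP //.
have iY : lin_iso (corner tri_inC (corner tri_prC Y)) Y.
  exact: restrict_inflate.
split=> [YYY|[_ YYY]]; last exact: torsion_iso iY YYY.
split; last exact: torsion_iso (lin_iso_sym iY) YYY.
exact/(torsion_zero tX)/restrict_inflate0.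
Qed.

Lemma covers_lower (XX XX' : modclass B) :
    torsion_class XX -> torsion_class XX' -> covers XX XX' ->
  covers (lower_class (M := M) XX) (lower_class XX').
Proof.
move=> tX tX' cX; have t0 := @torsion_zero_class C.
have sub : class_sub (glue XX (@zero_class C)) (glue XX' (@zero_class C)).
  by apply: glue_sub => //; case: cX.
change (covers (glue XX (@zero_class C)) (glue XX' (@zero_class C))).
apply: (covers_transfer (i := tri_inB) (p := tri_prB) tX tX') cX => //.
- exact: torsion_glue.
- exact: torsion_glue.
- by move=> X; apply: glue_inflateB.
- by move=> X; apply: glue_inflateB.
(* As V e' = 0, the inclusion of V e is onto. *)
move=> U tU _ _ V /(glueP tX' t0)[_ YV0].
have [j [q [j_inj _ ker]]] := tri_exact V.
have jV : lin_iso (corner tri_prB (corner tri_inB V)) V.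
  apply: inj_surj_lin_iso j_inj _ => v; apply/ker; apply: cval_inj.
  exact: YV0.
by split; apply: torsion_iso => //; apply: lin_iso_sym.
Qed.

Lemma covers_upper (YY YY' : modclass C) :
    torsion_class YY -> torsion_class YY' -> covers YY YY' ->
  covers (upper_class (M := M) YY) (upper_class YY').
Proof.
move=> tY tY' cY; have tM := @torsion_mod_class B.
have sub : class_sub (glue (@mod_class B) YY) (glue (@mod_class B) YY').
  by apply: glue_sub => //; case: cY.
change (covers (glue (@mod_class B) YY) (glue (@mod_class B) YY')).
apply: (covers_transfer (i := tri_inC) (p := tri_prC) tY tY') cY => //.
- exact: torsion_glue.
- exact: torsion_glue.
- by move=> Y; apply: glue_inflateC.
- by move=> Y; apply: glue_inflateC.
(* The submodule V e lies in the smaller class, hence in U. *)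
move=> U tU ZU _ V /(glueP tM tY')[XV _].
have [j [q [j_inj q_surj ker]]] := tri_exact V.
split=> [|UQ]; first exact: (torsion_image tU q_surj).
apply: (torsion_ext tU j_inj q_surj ker) UQ.
exact/ZU/(glue_inflateB _ tM tY).
Qed.

End TriangularModules.

Theorem theorem1p4 (k : fieldType) (B C : algebra k) (M : bimodule C B)
    (hB : fin_dim B) (hC : fin_dim C) (hM : bimod_fin_gen M)
    (r s : nat) (XX : nat -> modclass B) (YY : nat -> modclass C)
    (alpha : maximal_green_sequence r XX)
    (beta : maximal_green_sequence s YY) :
  maximal_green_sequence (r + s) (glued_sequence M r XX YY).
Proof.
case: alpha => tX /class_eqP X0 /class_eqP Xr cX.
case: beta => tY /class_eqP Y0 /class_eqP Ys cY.
have lowE i : (i <= r)%N -> glued_sequence M r XX YY i = lower_class (XX i).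
  by rewrite /glued_sequence => ->.
(* The two descriptions agree at the junction i = r, so the second one may be
   used from r on. *)
have upE i : (r <= i)%N ->
    glued_sequence M r XX YY i = upper_class (YY (i - r)%N).
  rewrite leq_eqVlt => /predU1P[<-|ri]; last first.
    by rewrite /glued_sequence leqNgt ri.
  by rewrite lowE // Xr subnn Y0.
split.
- move=> i i_rs; have [ir|/ltnW ri] := leqP i r.
    by rewrite lowE //; apply: torsion_glue (tX i ir) (@torsion_zero_class C).
  rewrite upE //; apply: torsion_glue (@torsion_mod_class B) (tY _ _).
  by rewrite leq_subLR.
- rewrite lowE // X0 => V.
  have t0 := (@torsion_zero_class B, @torsion_zero_class C).
  split=> [/(glueP t0.1 t0.2)[B0 C0] v|V0]; last first.
    exact: torsion_zero (torsion_glue M t0.1 t0.2) _ V0.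
  rewrite -[v]ract1 -tri_in1 ractDr -!cval_proj.
  by rewrite (B0 (corner_proj _ v)) (C0 (corner_proj _ v)) addr0.
- rewrite upE ?leq_addr // addKn Ys => V.
  have tM := (@torsion_mod_class B, @torsion_mod_class C).
  split=> [/(glueP tM.1 tM.2)[Bf Cf]|Vf]; first exact: tri_fin_gen.
  apply/(glueP tM.1 tM.2).
  by split; [apply: tri_inB_fin_gen | apply: tri_inC_fin_gen].
- move=> i i_rs; have [ir|ri] := ltnP i r.
    rewrite !lowE //; last exact: ltnW.
    by apply: covers_lower; [apply: tX; apply: ltnW | apply: tX | apply: cX].
  have i_s : (i - r < s)%N by rewrite ltn_subLR.
  rewrite !upE //; last exact: leqW.
  rewrite subSn //.
  by apply: covers_upper; [apply: tY; apply: ltnW | apply: tY | apply: cY].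
Qed.
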